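(* Let $\Lambda=\{mz+nw : m,n\in\mathbb{Z}\}$ be a lattice in $\mathbb{C}$, where $z,w\in\mathbb{C}$ are linearly independent over $\mathbb{R}$. Let $r>0$ be such that $\{\zeta:|\zeta-z_1|<r\}\cap\{\zeta:|\zeta-z_2|<r\}=\emptyset$ for all distinct $z_1,z_2\in\Lambda$, and let $$D=\mathbb{C}\setminus\bigcup_{z_1\in\Lambda}\{\zeta:|\zeta-z_1|<r\}.$$ Then $bh(T(D))=\infty$, i.e. $E_a[T(D)^p]<\infty$ for every $p>0$.
   Context: Planar Brownian motion $B_t$ with $B_0=a$; $E_a$ the corresponding expectation. $T(D)=\inf\{t\geq0:B_t\notin D\}$. For a stopping time $\tau$, $bh(\tau)=\sup\{p>0:E_a[\tau^p]<\infty\}$. *)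

(* Defs.v *)
(* The plane C is modelled as R * R (real and
   imaginary parts), with the Euclidean norm. *)
From HB Require Import structures.
From mathcomp Require Import all_boot all_order all_algebra.
From mathcomp Require Import all_classical all_reals all_analysis.
Set Implicit Arguments. Unset Strict Implicit. Unset Printing Implicit Defensive.
Import Order.TTheory GRing.Theory Num.Theory.
Import numFieldNormedType.Exports.
Local Open Scope classical_set_scope.
Local Open Scope ring_scope.

Section Defs.
Context {R : realType}.

Definition pt := (R * R)%type.

Definition padd (x y : pt) : pt := (x.1 + y.1, x.2 + y.2).
Definition psub (x y : pt) : pt := (x.1 - y.1, x.2 - y.2).
Definition pscale (c : R) (x : pt) : pt := (c * x.1, c * x.2).
Definition sqnorm (x : pt) : R := x.1 ^+ 2 + x.2 ^+ 2.
Definition edist (x y : pt) : R := Num.sqrt (sqnorm (psub x y)).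

Definition lin_indep (z w : pt) : Prop :=
  forall a b : R, padd (pscale a z) (pscale b w) = (0, 0) -> a = 0 /\ b = 0.

Definition lattice (z w : pt) : set pt :=
  [set padd (pscale (m%:~R) z) (pscale (n%:~R) w) | m in [set: int] & n in [set: int]].

Definition odisk (c : pt) (r : R) : set pt := [set x | edist x c < r].

Definition domD (z w : pt) (r : R) : set pt :=
  ~` (\bigcup_(l in lattice z w) odisk l r).

(* planar heat kernel / centered Gaussian density with covariance s I *)
Definition heat (s : R) (x : pt) : R :=
  (2 * pi * s)^-1 * expR (- sqnorm x / (2 * s)).

Definition leb2 := ((@lebesgue_measure R) \x (@lebesgue_measure R))%E.

Definition gauss2 (s : R) (A : set pt) : \bar R :=
  (\int[leb2]_(x in A) (heat s x)%:E)%E.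

Definition planar_BM {d} {Omega : measurableType d} (P : probability Omega R)
    (a : pt) (B : R -> Omega -> pt) : Prop :=
  [/\ (forall om, B 0 om = a),
      (forall om, {within [set t : R | 0 <= t], continuous (fun t => B t om)}),
      (forall t, 0 <= t -> measurable_fun setT (B t)) &
      (forall (n : nat) (t : nat -> R) (A : nat -> set pt),
         t 0%N = 0 ->
         (forall i, (i < n)%N -> t i < t i.+1) ->
         (forall i, (i < n)%N -> measurable (A i)) ->
         P (\bigcap_(i in `I_n) [set om | A i (psub (B (t i.+1) om) (B (t i) om))])
         = (\prod_(i < n) gauss2 (t i.+1 - t i) (A i))%E)].

(* exit time T(D) = inf {t >= 0 : B_t notin D}  (inf of empty set = +oo) *)
Definition exit_time {Omega : Type} (B : R -> Omega -> pt) (D : set pt)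
    (om : Omega) : \bar R :=
  ereal_inf [set t%:E | t in [set t : R | 0 <= t /\ ~ D (B t om)]].

Definition bh {d} {Omega : measurableType d} (P : probability Omega R)
    (tau : Omega -> \bar R) : \bar R :=
  ereal_sup [set p%:E | p in
    [set p : R | 0 < p /\ (\int[P]_om (poweR (tau om) p) < +oo)%E]].

End Defs.

(* Main.v *)
(* At each integer time the position lies within bounded distance of the centre
   of some disk, so, whatever the past, the next unit Gaussian increment leads
   into a disk with probability at least some [delta > 0] independent of the
   position. Hence T exceeds n with probability at most (1 - delta)^n, and all
   moments of T are finite. To use only the independence of increments over
   product events, the plane is cut into countably many small cells: from each
   cell one fixed square of increments leads into a disk from every point of the
   cell. *)
Require Import Defs.
From HB Require Import structures.
From mathcomp Require Import all_boot all_order all_algebra.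
From mathcomp Require Import all_classical all_reals all_analysis.
From mathcomp Require Import ring lra.
From mathcomp Require Import measurable_realfun.
Import Order.TTheory GRing.Theory Num.Theory.
Set Implicit Arguments.
Unset Strict Implicit.
Unset Printing Implicit Defensive.
Local Open Scope classical_set_scope.
Local Open Scope ring_scope.

(** * Moments from geometric tails *)

(** The integral of a nonnegative function, measurable or not, is a supremum over the simple
    functions below it, and a larger function has more of these. *)
Lemma ge0_le_integral_nonmeasurable d (T : measurableType d) (R : realType)
    (mu : {measure set T -> \bar R}) (D : set T) (f g : T -> \bar R) :
  (forall x, D x -> (0 <= f x)%E) -> (forall x, D x -> (f x <= g x)%E) ->
  (\int[mu]_(x in D) f x <= \int[mu]_(x in D) g x)%E.
Proof.
move=> f0 fg.
have g0 x : D x -> (0 <= g x)%E.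
  by move=> Dx; exact: le_trans (f0 x Dx) (fg x Dx).
rewrite !ge0_integralE//; apply: ge_ereal_sup => _ [h hf <-].
apply: ereal_sup_ubound; exists h => // x; apply: le_trans (hf x) _.
by rewrite /patch; case: ifPn => // /set_mem; exact: fg.
Qed.

(** With [L = - ln q], half of the decay rate [L] absorbs the power of [n.+1]; the other half is
    left in [s]. *)
Lemma powR_geometric_le (R : realType) (p q : R) : 0 < p -> 0 < q -> q < 1 ->
  exists C s : R, [/\ 0 <= C, 0 <= s, s < 1 &
    forall n, n.+1%:R `^ p * q ^+ n <= C * s ^+ n].
Proof.
move=> p0 q0 q1; pose L := - ln q.
have L0 : 0 < L by rewrite oppr_gt0 ln_lt0// q0.
(* Chosen so that the [p]-th power of [expR (eta * x)] grows at rate exactly [L / 2]. *)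
pose eta := L / (2 * p).
have eta0 : 0 < eta by rewrite divr_gt0// mulr_gt0.
pose s := expR (- (L / 2)).
(* The factor [expR (L / 2)] pays for the shift from [n] to [n.+1]. *)
exists (eta^-1 `^ p * expR (L / 2)), s; split.
- by rewrite mulr_ge0// ?powR_ge0 ?expR_ge0.
- exact: expR_ge0.
- by rewrite expR_lt1 oppr_lt0 divr_gt0.
move=> n; have le_exp : n.+1%:R <= eta^-1 * expR (eta * n.+1%:R).
  rewrite mulrC ler_pdivlMr// mulrC.
  by apply: le_trans (expR_ge1Dx _); rewrite lerDr.
have -> : q ^+ n = expR (- L * n%:R).
  by rewrite mulrC expRM_natl opprK lnK// posrE.
have -> : s ^+ n = expR (- (L / 2) * n%:R) by rewrite mulrC expRM_natl.
have powle : n.+1%:R `^ p <= eta^-1 `^ p * expR (L / 2 * n.+1%:R).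
  have -> : L / 2 * n.+1%:R = eta * n.+1%:R * p.
    by rewrite /eta; field; rewrite gt_eqF.
  rewrite expRM -powRM ?invr_ge0 ?expR_ge0 ?(ltW eta0)//.
  apply: ge0_ler_powR;
    by rewrite ?nnegrE ?mulr_ge0 ?invr_ge0 ?expR_ge0 ?(ltW eta0) ?(ltW p0).
apply: le_trans (ler_wpM2r (expR_ge0 _) powle) _.
rewrite -!mulrA -!expRD ler_wpM2l ?powR_ge0// ler_expR.
by rewrite -(natr1 n) le_eqVlt; apply/orP; left; apply/eqP; field.
Qed.

(* [tau] itself need not be measurable: it is dominated by a measurable
   combination of the events [S n]. *)
Lemma integral_poweR_geometric_tail d (T : measurableType d) (R : realType)
    (P : probability T R) (tau : T -> \bar R) (S : nat -> set T) (q p : R) :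
  0 < p -> 0 < q -> q < 1 ->
  (forall n, measurable (S n)) -> S 0%N = setT ->
  (forall n, (P (S n) <= (q ^+ n)%:E)%E) ->
  (forall x, (0 <= tau x)%E) ->
  (forall n x, ~ S n x -> (tau x <= n%:R%:E)%E) ->
  (\int[P]_x (poweR (tau x) p) < +oo)%E.
Proof.
move=> p0 q0 q1 mS S0 PS tau0 tauS.
pose f n x : \bar R := ((n.+1%:R `^ p)%:E * (\1_(S n) x)%:E)%E.
have f0 n x : (0 <= f n x)%E by rewrite /f -EFinM lee_fin mulr_ge0// powR_ge0.
have mf n : measurable_fun [set: T] (f n : T -> \bar R).
  apply: measurable_funeM; apply/measurable_EFinP.
  exact: measurable_indic.
apply: (@le_lt_trans _ _ (\int[P]_x (\sum_(0 <= n <oo) f n x))%E).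
  apply: ge0_le_integral_nonmeasurable => x _; first exact: poweR_ge0.
  (* Here [tau x] may be infinite; the series diverges too, as each of its terms is at least 1. *)
  have [all_S|] := pselect (forall n, S n x).
    suff -> : (\sum_(0 <= n <oo) f n x = +oo)%E by rewrite leey.
    apply/eqyP => A _; pose k := Num.truncn A.
    apply: le_trans (nneseries_lim_ge k.+1 _); last by move=> *; exact: f0.
    rewrite big_mkord; apply: (@le_trans _ _ (\sum_(i < k.+1) 1)%E).
      rewrite sumEFin lee_fin big_const_ord iter_addr addr0.
      by rewrite ltW// truncnS_gt.
    apply: lee_sum => i _; rewrite /f indicE mem_set// mule1 lee_fin.
    rewrite -[leLHS](powRr0 i.+1%:R).
    by apply: ler_powR; rewrite ?ler1n ?(ltW p0).
  move=> /existsNP exS.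
  have exb : exists n, `[< ~ S n x >].
    by case: exS => n Sn; exists n; exact: asboolT.
  (* If [m.+1] is the first index at which [S] fails, then [tau x <= m.+1] while [S m x] holds, so
     the single term [f m x] dominates. *)
  case: (ex_minnP exb) => [[|m]] /asboolP Sm mmin.
    by case: Sm; rewrite S0.
  have Smx : S m x.
    by apply: contrapT => nSm; have := mmin m (asboolT nSm); rewrite ltnn.
  apply: (@le_trans _ _ (f m x)).
    rewrite /f indicE mem_set// mule1 -poweR_EFin.
    apply: gt0_ler_poweR; first exact: ltW.
    - by rewrite in_itv/= tau0 leey.
    - by rewrite in_itv/= lee_fin ler0n leey.
    - exact: tauS.
  apply: le_trans (nneseries_lim_ge m.+1 _); last by move=> *; exact: f0.
  by rewrite big_nat_recr//= leeDr// sume_ge0.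
rewrite integral_nneseries//.
have [C [s [C0 s0 s1 Cs]]] := powR_geometric_le p0 q0 q1.
apply: (@le_lt_trans _ _ (\sum_(0 <= n <oo) (C * s ^+ n)%:E)%E).
  apply: lee_nneseries => [n _ _|n _].
    by apply: integral_ge0 => *; exact: f0.
  rewrite /f ge0_integralZl_EFin ?powR_ge0//; last first.
    apply/measurable_EFinP; exact: measurable_indic.
  rewrite integral_indic// setIT.
  apply: le_trans (_ : _ <= (n.+1%:R `^ p * q ^+ n)%:E)%E _.
    by rewrite EFinM; apply: lee_wpmul2l; rewrite ?lee_fin ?powR_ge0 ?PS.
  by rewrite lee_fin.
have := @cvg_geometric_series R C s; rewrite ger0_norm// => /(_ s1) cvs.
suff -> : (\sum_(0 <= n <oo) (C * s ^+ n)%:E)%E = (C / (1 - s))%:E.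
  by rewrite ltry.
apply/cvg_lim => //.
rewrite (_ : (fun _ => _) = EFin \o series (geometric C s)); last first.
  by apply/funext => n /=; rewrite sumEFin.
by apply/fine_cvgP; split; [exact: nearW|exact: cvs].
Qed.

(** * Squares, lattice points and Gaussian mass *)

Definition square (R : realType) (c : @pt R) (e : R) : set (@pt R) :=
  `]c.1 - e, c.1 + e[ `*` `]c.2 - e, c.2 + e[.

Lemma squareP (R : realType) (c : @pt R) (e : R) (x : @pt R) :
  square c e x <-> `|x.1 - c.1| < e /\ `|x.2 - c.2| < e.
Proof. by rewrite /square /= !in_itv /= !ltr_distl. Qed.

Lemma measurable_square (R : realType) (c : @pt R) (e : R) :
  measurable (square c e).
Proof. by apply: measurableX; exact: measurable_itv. Qed.

Lemma square_sub_odisk (R : realType) (c : @pt R) (r : R) : 0 < r ->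
  square c (r / 2) `<=` odisk c r.
Proof.
move=> r0 x /squareP[x1 x2].
rewrite /odisk/= /edist -[ltRHS](ger0_norm (ltW r0)) -sqrtr_sqr.
rewrite ltr_sqrt ?exprn_gt0//.
have sq y : `|y| < r / 2 -> y ^+ 2 < (r / 2) ^+ 2.
  move=> yr; rewrite -real_normK ?num_real//.
  by rewrite ltr_pXn2r// nnegrE ltW// divr_gt0.
rewrite /sqnorm /psub/=; have := sq _ x1; have := sq _ x2.
have := exprn_gt0 2 r0; nra.
Qed.

(** If the determinant vanished, [w.2 z - z.2 w] and [w.1 z - z.1 w] would be zero, so independence
    would force [z = w = 0], which contradicts independence. *)
Lemma lattice_det_neq0 (R : realType) (z w : @pt R) :
  lin_indep z w -> z.1 * w.2 - z.2 * w.1 != 0.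
Proof.
move=> zw; apply/eqP => det0.
have [|w2 /eqP] := zw w.2 (- z.2).
  by rewrite /padd/pscale/=; congr pair; [rewrite -det0|]; ring.
rewrite oppr_eq0 => /eqP z2.
have [|w1 /eqP] := zw w.1 (- z.1).
  by rewrite /padd/pscale/=; congr pair; [|rewrite -[RHS]oppr0 -det0]; ring.
rewrite oppr_eq0 => /eqP z1.
have [|/eqP] := zw 1 1; last by rewrite oner_eq0.
by rewrite /padd/pscale/= z1 z2 w1 w2 mulr0 addr0.
Qed.

(** Cramer's rule gives the real coordinates [s], [t] of [x] in the basis [z], [w]; rounding them
    down changes each by at most 1. *)
Lemma lattice_near (R : realType) (z w x : @pt R) : lin_indep z w ->
  exists l, [/\ lattice z w l, `|l.1 - x.1| <= `|z.1| + `|w.1| &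
                `|l.2 - x.2| <= `|z.2| + `|w.2|].
Proof.
move=> /lattice_det_neq0; set D := _ - _ => D0.
pose s := (x.1 * w.2 - x.2 * w.1) / D.
pose t := (z.1 * x.2 - z.2 * x.1) / D.
have x1E : x.1 = s * z.1 + t * w.1 by rewrite /s/t/D; field.
have x2E : x.2 = s * z.2 + t * w.2 by rewrite /s/t/D; field.
have fracP (y : R) : `|(Num.floor y)%:~R - y| <= 1.
  have /andP[y1 y2] := floor_itv y; rewrite intrD in y2.
  by rewrite distrC ger0_norm ?subr_ge0// lerBlDl ltW.
have bound (a b : R) : `|(Num.floor s)%:~R * a + (Num.floor t)%:~R * b
    - (s * a + t * b)| <= `|a| + `|b|.
  have -> : (Num.floor s)%:~R * a + (Num.floor t)%:~R * b - (s * a + t * b) =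
    ((Num.floor s)%:~R - s) * a + ((Num.floor t)%:~R - t) * b by ring.
  apply: le_trans (ler_normD _ _) _; rewrite !normrM.
  by apply: lerD; rewrite ler_piMl.
exists (padd (pscale (Num.floor s)%:~R z) (pscale (Num.floor t)%:~R w)).
rewrite x1E x2E; split; [|exact: bound..].
by exists (Num.floor s) => //; exists (Num.floor t).
Qed.

(** On every such square the density is at least its value at the corner [(M + e, M + e)], and the
    area is [(2e)^2]; both are independent of [u]. *)
Lemma gauss2_square_ge (R : realType) (M e : R) : 0 <= M -> 0 < e ->
  exists2 delta : R, 0 < delta & forall u : @pt R, `|u.1| <= M -> `|u.2| <= M ->
    (delta%:E <= gauss2 1 (square u e))%E.
Proof.
move=> M0 e0; pose h : R := heat 1 (M + e, M + e).
have h0 : 0 < h.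
  by rewrite /h/heat mulr_gt0 ?expR_gt0// invr_gt0 !mulr_gt0// pi_gt0.
exists (h * (e + e) ^+ 2); first by rewrite mulr_gt0// exprn_gt0// addr_gt0.
move=> u u1 u2.
have -> : (h * (e + e) ^+ 2)%:E = (\int[leb2]_(x in square u e) h%:E)%E.
  rewrite integral_cst; last exact: measurable_square.
  rewrite [X in (_ * X)%E]product_measure1E; try exact: measurable_itv.
  have len c : lebesgue_measure `]c - e, c + e[ = (e + e)%:E.
    rewrite lebesgue_measure_itv/= lte_fin ifT.
      by rewrite -EFinB; congr EFin; ring.
    by rewrite ltrBlDr -addrA ltrDl addr_gt0.
  by rewrite [X in (_ * (X * _))%E]len [X in (_ * (_ * X))%E]len -!EFinM.
apply: ge0_le_integral_nonmeasurable => x; first by rewrite lee_fin ltW.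
move=> /squareP[x1 x2]; rewrite lee_fin /h /heat.
rewrite ler_wpM2l ?invr_ge0 ?mulr_ge0 ?pi_ge0//.
rewrite ler_expR ler_pM2r ?invr_gt0// lerN2 /sqnorm/=.
have sq (a b : R) : `|b| <= M -> `|a - b| < e -> a ^+ 2 <= (M + e) ^+ 2.
  move=> bM ab; rewrite -real_normK ?num_real//.
  rewrite ler_pXn2r ?nnegrE ?addr_ge0 ?(ltW e0)//.
  by rewrite -[a](subrK b) (le_trans (ler_normD _ _))// addrC lerD// ltW.
by apply: lerD; [exact: sq x1|exact: sq x2].
Qed.

Lemma square_cover (R : realType) (e : R) : 0 < e ->
  exists c : nat -> @pt R, \bigcup_k square (c k) e = setT.
Proof.
move=> e0; pose c k : @pt R :=
  if @unpickle (int * int)%type k is Some ij then (ij.1%:~R * e, ij.2%:~R * e)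
  else (0, 0).
exists c; apply/seteqP; split => // x _.
exists (pickle (Num.floor (x.1 / e), Num.floor (x.2 / e))) => //.
apply/squareP; rewrite /c pickleK/=.
have cell (y : R) : `|y - (Num.floor (y / e))%:~R * e| < e.
  have /andP[y1 y2] := floor_itv (y / e).
  rewrite ger0_norm ?subr_ge0 -?ler_pdivlMr// ltrBlDl.
  by rewrite -[X in _ + X]mul1r -mulrDl -ltr_pdivrMr// -[1]/(1%:~R) -intrD.
by split; exact: cell.
Qed.

(** * Independence of the unit increments *)

Lemma bigcap_IIS (T : Type) n (F : nat -> set T) :
  \bigcap_(i in `I_n.+1) F i = (\bigcap_(i in `I_n) F i) `&` F n.
Proof. by rewrite IIS bigcap_setU bigcap_set1. Qed.

Lemma bigcap_eqT (T I : Type) (D : set I) (F : I -> set T) :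
  (forall i, D i -> F i = setT) -> \bigcap_(i in D) F i = setT.
Proof. by move=> FT; apply/seteqP; split => // x _ i Di; rewrite FT. Qed.

Section unit_increments.
Context (R : realType) (d : measure_display) (Omega : measurableType d)
  (P : probability Omega R) (a : @pt R) (B : R -> Omega -> @pt R)
  (BM : planar_BM P a B).

Definition incr (n : nat) (om : Omega) : @pt R :=
  psub (B n.+1%:R om) (B n%:R om).

(** Product events of the first [n] unit increments: an intersection-stable family generating the
    past up to time [n] along integer times. *)
Definition cylinder (n : nat) : set (set Omega) :=
  [set E | exists2 A : nat -> set (@pt R), (forall i, measurable (A i)) &
           E = \bigcap_(i in `I_n) (incr i @^-1` A i)].

Lemma measurable_incr n : measurable_fun [set: Omega] (incr n).
Proof.
have [_ _ mB _] := BM.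
have m0 := mB _ (ler0n R n.+1); have m1 := mB _ (ler0n R n).
by apply: measurable_fun_pair; apply: measurable_funB;
  apply: measurableT_comp => //.
Qed.

Lemma measurable_incr_preimage n A :
  measurable A -> measurable (incr n @^-1` A).
Proof. by move=> mA; rewrite -[_ @^-1` _]setTI; exact: measurable_incr. Qed.

Lemma cylinder_setI_closed n : setI_closed (cylinder n).
Proof.
move=> _ _ [A mA ->] [A' mA' ->]; exists (fun i => A i `&` A' i).
  by move=> i; exact: measurableI.
by rewrite -bigcapI.
Qed.

Lemma cylinder_measurable n E : <<s cylinder n >> E -> measurable E.
Proof.
apply: smallest_sub => [|_ [A mA ->]]; first exact: sigma_algebra_measurable.
by apply: bigcap_measurableType => i _; exact: measurable_incr_preimage.
Qed.

Lemma probability_cylinder n (A : nat -> set (@pt R)) :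
  (forall i, measurable (A i)) ->
  P (\bigcap_(i in `I_n) (incr i @^-1` A i)) = (\prod_(i < n) gauss2 1 (A i))%E.
Proof.
move=> mA; have [_ _ _ incrP] := BM.
have := incrP n (fun i => i%:R) A erefl.
rewrite /incr => ->.
- by apply: eq_bigr => i _; congr gauss2; rewrite -natr1 addrAC subrr add0r.
- by move=> i _; rewrite ltr_nat.
- by move=> i _; exact: mA.
Qed.

(** Dynkin's argument: on product events the identity is the increment law for [n.+1] steps, and the
    events satisfying it form a Dynkin class. *)
Lemma incr_indep n E A : <<s cylinder n >> E -> measurable A ->
  P (E `&` incr n @^-1` A) = (P E * gauss2 1 A)%E.
Proof.
move=> sE mA; have mnA := measurable_incr_preimage n mA.
pose H : set (set Omega) := [set E | measurable E /\
  P (E `&` incr n @^-1` A) = (P E * gauss2 1 A)%E].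
suff: H E by case.
(* Leaving the first [n] increments free identifies [gauss2 1 A] with a probability; it is thus
   finite, as the subtraction for complements requires. *)
have HT : H setT.
  split => //; rewrite setTI probability_setT mul1e.
  pose A' i := if (i == n)%N then A else setT.
  have mA' i : measurable (A' i) by rewrite /A'; case: ifP.
  have := probability_cylinder n.+1 mA'; rewrite bigcap_IIS big_ord_recr/=.
  rewrite -(probability_cylinder n mA') /A' eqxx bigcap_eqT => [|i]; last first.
    by move=> /= i_n; rewrite ltn_eqF.
  by rewrite setTI probability_setT mul1e.
have Hfin : gauss2 1 A \is a fin_num.
  have [_] := HT; rewrite setTI probability_setT mul1e => <-.
  exact: fin_num_measure.
have cylI := @cylinder_setI_closed n.
move: sE; rewrite -(setI_closed_g_dynkin_g_sigma_algebra cylI).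
apply: smallest_sub => [|_ [C mC ->]]; last first.
  split.
    by apply: bigcap_measurableType => i _; exact: measurable_incr_preimage.
  pose C' i := if (i == n)%N then A else C i.
  have mC' i : measurable (C' i) by rewrite /C'; case: ifP.
  have CC' : \bigcap_(i in `I_n) (incr i @^-1` C i) =
      \bigcap_(i in `I_n) (incr i @^-1` C' i).
    by apply: eq_bigcapr => i /= i_n; rewrite /C' ltn_eqF.
  have := probability_cylinder n.+1 mC'; rewrite bigcap_IIS big_ord_recr/=.
  by rewrite -(probability_cylinder n mC') -CC' /C' eqxx.
split => // [F [mF PF]|F tF HF].
  split; first exact: measurableC.
  rewrite setIC -setDE measureD ?fin_num_fun_lty//; last first.
    by apply: (le_lt_trans (probability_le1 _ _)) => //; rewrite ltry.
  rewrite [X in (_ - P X)%E]setIC [X in (_ - X)%E]PF probability_setC//.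
  have [_] := HT; rewrite setTI probability_setT mul1e => PA.
  rewrite [X in (X - _)%E]PA.
  by rewrite muleBl// ?mul1e// ?fin_num_measure.
have mF k : measurable (F k) by have [] := HF k.
split; first exact: bigcup_measurable.
rewrite setI_bigcupl !measure_bigcup//.
- have gA : gauss2 1 A = (fine (gauss2 1 A))%:E by rewrite fineK.
  rewrite [in RHS]gA muleC -nneseriesZl; last by move=> *; exact: measure_ge0.
  by apply: eq_eseriesr => i _; rewrite -gA muleC; have [] := HF i.
- by move=> i _; exact: measurableI.
- by apply: trivIset_setIr.
Qed.

Lemma cylinderS n : <<s cylinder n >> `<=` <<s cylinder n.+1 >>.
Proof.
apply: smallest_sub; first exact: smallest_sigma_algebra.
move=> _ [A mA ->]; apply: sub_gen_smallest.
exists (fun i => if (i == n)%N then setT else A i).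
  by move=> i; case: ifP.
rewrite bigcap_IIS eqxx preimage_setT setIT.
by apply: eq_bigcapr => i /= i_n; rewrite ltn_eqF.
Qed.

Lemma incr_cylinder n A : measurable A -> <<s cylinder n.+1 >> (incr n @^-1` A).
Proof.
move=> mA; apply: sub_gen_smallest.
exists (fun i => if (i == n)%N then A else setT); first by move=> i; case: ifP.
by rewrite bigcap_IIS eqxx bigcap_eqT ?setTI// => i /= i_n; rewrite ltn_eqF.
Qed.

(** The position at time [n] is the constant [a] plus the first [n] increments. *)
Lemma position_cylinder n A : measurable A ->
  <<s cylinder n >> (B n%:R @^-1` A).
Proof.
suff mB : @measurable_fun _ _ (g_sigma_algebraType (cylinder n)) _ setT
    (B n%:R : _ -> @pt R).
  by move=> mA; rewrite -[_ @^-1` _]setTI; exact: mB.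
have [B0 _ _ _] := BM.
elim: n => [|n IHn].
  by rewrite (_ : B 0%:R = cst a)//; apply/funext.
rewrite (_ : B n.+1%:R = fun om => padd (B n%:R om) (incr n om)); last first.
  by apply/funext => om; rewrite /padd/incr/psub/= !subrKC -surjective_pairing.
have mBn : @measurable_fun _ _ (g_sigma_algebraType (cylinder n.+1)) _ setT
    (B n%:R : _ -> @pt R).
  by move=> _ A' mA'; apply: cylinderS; exact: IHn.
have mIn : @measurable_fun _ _ (g_sigma_algebraType (cylinder n.+1)) _ setT
    (incr n : _ -> @pt R).
  by move=> _ A' mA'; rewrite setTI; exact: incr_cylinder.
by apply: measurable_fun_pair; apply: measurable_funD;
  apply: measurableT_comp => //.
Qed.

Lemma probability_incr n A : measurable A ->
  P (incr n @^-1` A) = gauss2 1 A.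
Proof.
move=> mA.
have sT : <<s cylinder n >> setT.
  by rewrite -(preimage_setT (B n%:R)); exact: position_cylinder.
by have := incr_indep sT mA; rewrite setTI probability_setT mul1e.
Qed.

(** * Geometric decay of the survival probability *)

(* This contains the paths that are in the domain at times 0, ..., n, provided
   that increments in [W k] lead from [V k] out of the domain (see
   [avoid_survive]), and it is measurable whether or not the domain is. *)
Fixpoint survive (V W : nat -> set (@pt R)) (n : nat) : set Omega :=
  if n is m.+1 then
    \bigcup_k (survive V W m `&` (B m%:R @^-1` V k) `&` (incr m @^-1` ~` W k))
  else setT.

Lemma survive_cylinder V W n :
  (forall k, measurable (V k)) -> (forall k, measurable (W k)) ->
  <<s cylinder n >> (survive V W n).
Proof.
move=> mV mW; elim: n => [|n IHn] /=.
  by rewrite -(preimage_setT (B 0%:R)); exact: position_cylinder.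
apply: sigma_algebra_bigcup => k.
apply: (@measurableI _ (g_sigma_algebraType (cylinder n.+1))); last first.
  by apply: incr_cylinder; exact: measurableC.
apply: cylinderS.
apply: (@measurableI _ (g_sigma_algebraType (cylinder n))) => //.
exact: position_cylinder.
Qed.

(** On each cell the past is independent of the next increment, which misses [W k] with probability
    at most [q]; summing over cells gains one factor [q] per step. *)
Lemma probability_survive V W q n :
  (forall k, measurable (V k)) -> (forall k, measurable (W k)) ->
  trivIset setT V -> 0 <= q -> (forall k, (gauss2 1 (~` W k) <= q%:E)%E) ->
  (P (survive V W n) <= (q ^+ n)%:E)%E.
Proof.
move=> mV mW tV q0 Wq; elim: n => [|n IHn].
  by rewrite /= probability_setT.
have sS : <<s cylinder n >> (survive V W n) by exact: survive_cylinder.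
have mS : measurable (survive V W n) by exact: cylinder_measurable sS.
have sSV k : <<s cylinder n >> (survive V W n `&` (B n%:R @^-1` V k)).
  apply: (@measurableI _ (g_sigma_algebraType (cylinder n))) => //.
  exact: position_cylinder.
have mSV k : measurable (survive V W n `&` (B n%:R @^-1` V k)).
  exact: cylinder_measurable (sSV k).
have mSVW k : measurable
    (survive V W n `&` (B n%:R @^-1` V k) `&` (incr n @^-1` ~` W k)).
  apply: measurableI => //; apply: measurable_incr_preimage.
  exact: measurableC.
apply: le_trans (generalized_Boole_inequality P mSVW _) _.
  exact: bigcup_measurable.
apply: (@le_trans _ _ (\sum_(0 <= k <oo)
    (q%:E * P (survive V W n `&` (B n%:R @^-1` V k))))%E).
  apply: lee_nneseries => k; first by move=> *; exact: measure_ge0.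
  move=> _; rewrite [X in (X <= _)%E]incr_indep//; last exact: measurableC.
  by rewrite muleC lee_wpmul2r.
rewrite nneseriesZl; last by move=> *; exact: measure_ge0.
rewrite exprS EFinM lee_wpmul2l ?lee_fin//; apply: le_trans IHn.
(* Disjointness of the [V k] makes the pieces add up to the probability of one event inside
   [survive V W n]. *)
rewrite -[X in (X <= _)%E](measure_semi_bigcup P mSV); last 2 first.
- apply: trivIset_setIl => i j _ _ [om [Vi Vj]].
  by apply: tV => //; exists (B n%:R om).
- exact: bigcup_measurable.
apply: le_measure; rewrite ?inE//; first exact: bigcup_measurable.
by apply: bigcup_sub => k _; exact: subIsetl.
Qed.

Lemma avoid_survive V W (D : set (@pt R)) n om : \bigcup_k V k = setT ->
  (forall k x y, V k x -> W k y -> ~ D (padd x y)) ->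
  (forall i, (i <= n)%N -> D (B i%:R om)) -> survive V W n om.
Proof.
move=> VT VWD; elim: n => [//|n IHn] DB.
have [k _ Vk] : (\bigcup_k V k) (B n%:R om) by rewrite VT.
exists k => //; split; first by split=> //; apply: IHn => i /leqW/DB.
move=> Wk; apply: VWD Vk Wk _.
have -> : padd (B n%:R om) (incr n om) = B n.+1%:R om.
  by rewrite /padd/incr/psub/= !subrKC -surjective_pairing.
exact: DB.
Qed.

End unit_increments.

(** * Moments of the exit time *)

Theorem theorem4p1 (R : realType) (z w : @pt R) (r : R)
    (d : measure_display) (Omega : measurableType d) (P : probability Omega R)
    (a : @pt R) (B : R -> Omega -> @pt R) :
  lin_indep z w ->
  0 < r ->
  (forall z1 z2, lattice z w z1 -> lattice z w z2 -> z1 <> z2 ->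
     odisk z1 r `&` odisk z2 r = set0) ->
  planar_BM P a B ->
  bh P (exit_time B (domD z w r)) = +oo%E /\
  (forall p : R, 0 < p ->
     (\int[P]_om (poweR (exit_time B (domD z w r) om) p) < +oo)%E).
Proof.
move=> zw r0 _ BM.
suff moments (p : R) : 0 < p ->
    (\int[P]_om (poweR (exit_time B (domD z w r) om) p) < +oo)%E.
  split=> //; apply/eqyP => p p0; apply: ereal_sup_ubound.
  by exists p => //; split=> //; exact: moments.
(* Cell and increment each contribute an error [e] per coordinate, together the [r / 2] that keeps a
   square inside the disk. *)
move=> p0; pose e := r / 4; have e0 : 0 < e by rewrite divr_gt0.
have [c cT] := square_cover e0.
have [l lP] := choice (fun k => lattice_near (c k) zw).
pose M := (`|z.1| + `|w.1|) + (`|z.2| + `|w.2|).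
have M0 : 0 <= M by rewrite !addr_ge0.
have [delta delta0 gauss_ge] := gauss2_square_ge M0 e0.
(* The covering squares overlap, so they are made disjoint; [W k] is centred at the displacement
   from the cell centre to a nearby lattice point. *)
pose V := seqDU (fun k => square (c k) e).
pose W k := square (psub (l k) (c k)) e.
have mV k : measurable (V k).
  by apply: seqDU_measurable => i; exact: measurable_square.
have mW k : measurable (W k) by exact: measurable_square.
have VT : \bigcup_k V k = setT by rewrite -seqDU_bigcup_eq.
have VWD k x y : V k x -> W k y -> ~ domD z w r (padd x y).
  move=> Vx Wy; have /squareP[x1 x2] : square (c k) e x := subset_seqDU Vx.
  have /squareP[y1 y2] : square (psub (l k) (c k)) e y := Wy.
  apply.
  have [lk _ _] := lP k; exists (l k) => //; apply: square_sub_odisk => //.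
  apply/squareP; have -> : r / 2 = e + e by rewrite /e; field.
  move: y1 y2; rewrite /psub/padd/= => y1 y2; split.
    have -> : x.1 + y.1 - (l k).1 =
      (x.1 - (c k).1) + (y.1 - ((l k).1 - (c k).1)) by ring.
    by rewrite (le_lt_trans (ler_normD _ _))// ltrD.
  have -> : x.2 + y.2 - (l k).2 =
    (x.2 - (c k).2) + (y.2 - ((l k).2 - (c k).2)) by ring.
  by rewrite (le_lt_trans (ler_normD _ _))// ltrD.
(* The maximum with 1/2 keeps [q] positive whatever the size of [delta]. *)
pose q : R := Num.max (1 - delta) 2^-1.
have Wq k : (gauss2 1 (~` W k) <= q%:E)%E.
  rewrite -(probability_incr BM 0); last exact: measurableC.
  rewrite -preimage_setC probability_setC; last first.
    exact: measurable_incr_preimage BM _ _ _.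
  have [_ l1 l2] := lP k.
  have : (delta%:E <= P (incr B 0 @^-1` W k))%E.
    rewrite (probability_incr BM)//; apply: gauss_ge; rewrite /psub/=.
      by rewrite (le_trans l1)// lerDl addr_ge0.
    by rewrite (le_trans l2)// lerDr addr_ge0.
  move=> dW; apply: (@le_trans _ _ (1 - delta%:E)%E); first exact: leeB.
  by rewrite -EFinB lee_fin le_max lexx.
have q0 : 0 < q by rewrite lt_max; apply/orP; right; lra.
apply: (@integral_poweR_geometric_tail _ _ _ P _ (survive B V W) q) => //.
- by rewrite gt_max; apply/andP; split; lra.
- by move=> n; apply: (cylinder_measurable BM); exact: (survive_cylinder BM).
- move=> n; apply: (probability_survive BM) => //; last exact: ltW.
  exact: trivIset_seqDU.
- by move=> om; apply/ereal_infP => _ [t [t0 _] <-]; rewrite lee_fin.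
move=> n om nS.
(* Outside [survive] the path is out of the domain at some integer time [i <= n], which bounds the
   infimum defining the exit time. *)
have [i i_n DBi] : exists2 i, (i <= n)%N & ~ domD z w r (B i%:R om).
  apply: contrapT => nD; apply: nS; apply: avoid_survive VT VWD _ => i i_n.
  by apply: contrapT => DBi; apply: nD; exists i.
apply: (@le_trans _ _ i%:R%:E); last by rewrite lee_fin ler_nat.
by apply: ereal_inf_lbound; exists i%:R.
Qed.
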